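(* Let $\mathbb{K}$ be a field and let $F:\mathcal{S}\to\mathcal{P}$ be a full poset morphism between connected posets. (a) Suppose that $\mathcal{P}={\downarrow}\mathcal{T}$ for some finite subposet $\mathcal{T}\subseteq\mathcal{P}$, and that for all subposets $\mathcal{A},\mathcal{B}\subseteq\mathcal{P}$ with $\mathcal{A}\cap\mathcal{B}\neq\emptyset$, each of the form ${\downarrow}p$ or ${\downarrow}p\cap{\uparrow}q$ for some $p,q\in\mathcal{P}$, we have $\max(\mathcal{A}\cap\mathcal{B})\neq\emptyset$. If $\mathrm{mult}(\mathbb{K}_{\mathcal{P}},M)=\mathrm{mult}(\mathbb{K}_{\mathcal{S}},MF)$ for all functors $M:\mathcal{P}\to\mathrm{vect}_{\mathbb{K}}$, then $F$ is final. (b) Suppose that $\mathcal{P}={\uparrow}\mathcal{T}$ for some finite subposet $\mathcal{T}\subseteq\mathcal{P}$, and that for all subposets $\mathcal{A},\mathcal{B}\subseteq\mathcal{P}$ with $\mathcal{A}\cap\mathcal{B}\neq\emptyset$, each of the form ${\uparrow}p$ or ${\uparrow}p\cap{\downarrow}q$ for some $p,q\in\mathcal{P}$, we have $\min(\mathcal{A}\cap\mathcal{B})\neq\emptyset$. If $\mathrm{mult}(\mathbb{K}_{\mathcal{P}},M)=\mathrm{mult}(\mathbb{K}_{\mathcal{S}},MF)$ for all functors $M:\mathcal{P}\to\mathrm{vect}_{\mathbb{K}}$, then $F$ is initial.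
   Context: Posets are viewed as categories (a unique morphism $p\to q$ exactly when $p\le q$). A poset morphism (functor) $F:\mathcal{S}\to\mathcal{P}$ is full if for all $s,s'\in\mathcal{S}$: $s\le s'$ if and only if $F(s)\le F(s')$. A poset is connected if it is nonempty and any two elements are joined by a finite zigzag of comparable elements. ${\uparrow}p=\{q: p\le q\}$, ${\downarrow}p=\{q:q\le p\}$, ${\uparrow}\mathcal{T}=\bigcup_{t\in\mathcal{T}}{\uparrow}t$, ${\downarrow}\mathcal{T}=\bigcup_{t\in\mathcal{T}}{\downarrow}t$; $\max\mathcal{A}$ and $\min\mathcal{A}$ are the sets of maximal, respectively minimal, elements of $\mathcal{A}$. $F$ is final (resp. initial) if for every $p\in\mathcal{P}$ the full subposet $F^{-1}({\uparrow}p)$ (resp. $F^{-1}({\downarrow}p)$) of $\mathcal{S}$, which is isomorphic to the comma category $p/F$ (resp. $F/p$), is nonempty and connected. $\mathrm{vect}_{\mathbb{K}}$ is the category of finite-dimensional $\mathbb{K}$-vector spaces; $MF=M\circ F$. For a connected poset $\mathcal{P}$, $\mathbb{K}_{\mathcal{P}}$ is the constant functor with value $\mathbb{K}$ and all maps $\mathrm{id}_{\mathbb{K}}$; $\mathrm{mult}(\mathbb{K}_{\mathcal{P}},M)$ is the largest number $k$ such that $M\cong(\mathbb{K}_{\mathcal{P}})^{k}\oplus N$ for some functor $N:\mathcal{P}\to\mathrm{vect}_{\mathbb{K}}$ (pointwise direct sums). *)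

(* Defs.v *)
From HB Require Import structures.
From mathcomp Require Import all_boot all_order all_algebra.
From mathcomp Require Import boolp classical_sets functions cardinality.

Set Implicit Arguments.
Unset Strict Implicit.
Unset Printing Implicit Defensive.

Import Order.TTheory GRing.Theory.

Local Open Scope classical_set_scope.
Local Open Scope ring_scope.

(* Posets may be infinite; subposets are classical [set]s, and the boolean order
   of [porderType] is no restriction classically. *)

Section Posets.
Local Open Scope order_scope.
Variables (d : Order.disp_t) (T : porderType d).
Implicit Types (x y p : T) (A : set T).

Definition up p : set T := [set q | p <= q].
Definition down p : set T := [set q | q <= p].
Definition upset A : set T := \bigcup_(t in A) up t.
Definition downset A : set T := \bigcup_(t in A) down t.

Definition maxs A : set T := [set m | A m /\ forall x, A x -> m <= x -> x = m].
Definition mins A : set T := [set m | A m /\ forall x, A x -> x <= m -> x = m].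

(* The zigzag is required to stay inside A, i.e., A is connected as a full
   subposet. *)
Definition connected_poset A : Prop :=
  A !=set0 /\
  forall x y, A x -> A y ->
    exists s : seq T,
      [/\ forall z, z \in s -> A z, path >=<%O x s & last x s = y].

Definition down_shape A : Prop :=
  exists p, A = down p \/ exists q, A = down p `&` up q.
Definition up_shape A : Prop :=
  exists p, A = up p \/ exists q, A = up p `&` down q.

End Posets.

Section PosetMorphisms.
Local Open Scope order_scope.
Variables (dS dP : Order.disp_t) (S : porderType dS) (P : porderType dP).
Variable F : {omorphism S -> P}.

Definition full : Prop := {mono F : s s' / s <= s'}.
Definition final : Prop := forall p : P, connected_poset (F @^-1` up p).
Definition initial : Prop := forall p : P, connected_poset (F @^-1` down p).

End PosetMorphisms.

(* Functors from the poset P to vect_K; [(p <= q)%O] is a boolean, so that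
   there is at most one arrow from p to q. *)
Record pfunctor (K : fieldType) (d : Order.disp_t) (P : porderType d) := Pfunctor {
  pobj :> P -> vectType K;
  pmap : forall p q : P, (p <= q)%O -> 'Hom(pobj p, pobj q);
  pmap_id : forall (p : P) (h : (p <= p)%O), pmap h = \1%VF;
  pmap_comp : forall (p q r : P) (hpq : (p <= q)%O) (hqr : (q <= r)%O)
    (hpr : (p <= r)%O), pmap hpr = (pmap hqr \o pmap hpq)%VF
}.

Section DirectSumMaps.
Variables (K : fieldType) (U V U' V' : vectType K).
Variables (f : 'Hom(U, U')) (g : 'Hom(V, V')) (k : nat).

Definition sum_fun (u : U * V) : U' * V' := (f u.1, g u.2).
Fact sum_fun_linear : linear sum_fun.
Proof. by move=> a [u v] [u' v']; rewrite /sum_fun /= !linearP. Qed.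
HB.instance Definition _ :=
  GRing.isLinear.Build K (U * V)%type (U' * V')%type _ sum_fun sum_fun_linear.
Definition sum_map : 'Hom((U * V)%type, (U' * V')%type) := linfun sum_fun.

Definition pow_fun (u : {ffun 'I_k -> U}) : {ffun 'I_k -> U'} :=
  [ffun i => f (u i)].
Fact pow_fun_linear : linear pow_fun.
Proof. by move=> a u v; apply/ffunP => i; rewrite !ffunE linearP. Qed.
HB.instance Definition _ :=
  GRing.isLinear.Build K {ffun 'I_k -> U} {ffun 'I_k -> U'} _ pow_fun
    pow_fun_linear.
Definition pow_map : 'Hom({ffun 'I_k -> U}, {ffun 'I_k -> U'}) :=
  linfun pow_fun.

Lemma sum_mapE u : sum_map u = (f u.1, g u.2).
Proof. by rewrite lfunE. Qed.

Lemma pow_mapE u : pow_map u = [ffun i => f (u i)].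
Proof. by rewrite lfunE. Qed.

End DirectSumMaps.

Section Functors.
Variables (K : fieldType) (d : Order.disp_t) (P : porderType d).
Implicit Types M N : pfunctor K P.

Fact const_id (p : P) (h : (p <= p)%O) :
  (\1 : 'Hom(K^o, K^o))%VF = \1%VF.
Proof. by []. Qed.
Fact const_comp (p q r : P) (hpq : (p <= q)%O) (hqr : (q <= r)%O)
  (hpr : (p <= r)%O) : (\1 : 'Hom(K^o, K^o))%VF = (\1 \o \1)%VF.
Proof. by rewrite comp_lfun1l. Qed.
Definition const_pf : pfunctor K P :=
  @Pfunctor K d P (fun=> K^o) (fun _ _ _ => \1%VF) const_id const_comp.

Section Sum.
Variables M N : pfunctor K P.
Let mor p q (h : (p <= q)%O) := sum_map (pmap M h) (pmap N h).
Fact sum_id (p : P) (h : (p <= p)%O) : mor h = \1%VF.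
Proof.
by apply/lfunP => -[u v]; rewrite sum_mapE !pmap_id !lfunE.
Qed.
Fact sum_comp (p q r : P) (hpq : (p <= q)%O) (hqr : (q <= r)%O)
  (hpr : (p <= r)%O) : mor hpr = (mor hqr \o mor hpq)%VF.
Proof.
apply/lfunP => -[u v]; rewrite comp_lfunE !sum_mapE /=.
by rewrite (pmap_comp _ hpq hqr hpr) (pmap_comp _ hpq hqr hpr) !comp_lfunE.
Qed.
Definition sum_pf : pfunctor K P :=
  @Pfunctor K d P (fun p => (M p * N p)%type) mor sum_id sum_comp.
End Sum.

Section Pow.
Variables (M : pfunctor K P) (k : nat).
Let mor p q (h : (p <= q)%O) := pow_map (pmap M h) k.
Fact pow_id (p : P) (h : (p <= p)%O) : mor h = \1%VF.
Proof.
by apply/lfunP => u; apply/ffunP => i; rewrite pow_mapE ffunE pmap_id !lfunE.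
Qed.
Fact pow_comp (p q r : P) (hpq : (p <= q)%O) (hqr : (q <= r)%O)
  (hpr : (p <= r)%O) : mor hpr = (mor hqr \o mor hpq)%VF.
Proof.
apply/lfunP => u; apply/ffunP => i; rewrite comp_lfunE !pow_mapE !ffunE.
by rewrite (pmap_comp _ hpq hqr hpr) comp_lfunE.
Qed.
Definition pow_pf : pfunctor K P :=
  @Pfunctor K d P (fun p => {ffun 'I_k -> M p}) mor pow_id pow_comp.
End Pow.

Definition natural M N (f : forall p : P, 'Hom(M p, N p)) : Prop :=
  forall (p q : P) (h : (p <= q)%O),
    (f q \o pmap M h)%VF = (pmap N h \o f p)%VF.

Definition pf_iso M N : Prop :=
  exists (f : forall p : P, 'Hom(M p, N p)) (g : forall p : P, 'Hom(N p, M p)),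
    [/\ natural f, natural g,
        forall p, (g p \o f p)%VF = \1%VF & forall p, (f p \o g p)%VF = \1%VF].

Definition const_summand M (k : nat) : Prop :=
  exists N : pfunctor K P, pf_iso M (sum_pf (pow_pf const_pf k) N).

Definition is_mult M (k : nat) : Prop :=
  const_summand M k /\ forall j : nat, const_summand M j -> (j <= k)%N.

(* mult(K_P, M); the largest k exists whenever P is nonempty, see [multP]
   below, so the default value is irrelevant for connected P. *)
Definition mult M : nat := xget 0%N [set k | is_mult M k].

Lemma const_summand0 M : const_summand M 0.
Proof.
exists M.
pose i p (u : M p) : {ffun 'I_0 -> K^o} * M p := (0, u).
have i_lin p : linear (@i p).
  by move=> a u v; rewrite /i; congr pair => /=; rewrite scaler0 addr0.
have pr_lin p : linear (fun u : ({ffun 'I_0 -> K^o} * M p)%type => u.2).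
  by move=> a u v.
pose iL p := GRing.isLinear.Build _ _ _ _ _ (@i_lin p).
pose il p : {linear M p -> ({ffun 'I_0 -> K^o} * M p)%type} :=
  HB.pack (@i p) (iL p).
pose rL p := GRing.isLinear.Build _ _ _ _ _ (@pr_lin p).
pose rl p : {linear ({ffun 'I_0 -> K^o} * M p)%type -> M p} :=
  HB.pack (fun u : ({ffun 'I_0 -> K^o} * M p)%type => u.2) (rL p).
have triv (u v : {ffun 'I_0 -> K^o}) : u = v by apply/ffunP => -[].
exists (fun p => linfun (il p)), (fun p => linfun (rl p)); split.
- move=> p q h; apply/lfunP => u; rewrite !comp_lfunE !(lfunE (il _)) sum_mapE.
  by congr pair; apply: triv.
- by move=> p q h; apply/lfunP => u; rewrite !comp_lfunE !(lfunE (rl _)) sum_mapE.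
- by move=> p; apply/lfunP => u; rewrite comp_lfunE (lfunE (il _)) (lfunE (rl _)) id_lfunE.
- move=> p; apply/lfunP => -[u v].
  rewrite comp_lfunE (lfunE (rl _)) (lfunE (il _)) id_lfunE.
  by congr pair; apply: triv.
Qed.

Lemma const_summand_le_dim M (k : nat) (p : P) :
  const_summand M k -> (k <= \dim {: M p})%N.
Proof.
case=> N [f [g [_ _ _ fg]]].
have injg : lker (g p) == 0%VS.
  by apply/lker0P => u v e; rewrite -[u]id_lfunE -[v]id_lfunE -(fg p) !comp_lfunE e.
have e : \dim (g p @: fullv) = \dim {: ({ffun 'I_k -> K^o} * N p)%type}.
  by apply: limg_dim_eq; rewrite (eqP injg) capv0.
apply: leq_trans (dimvS (subvf (g p @: fullv)%VS)); rewrite e dimvf.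
have -> : dim (sum_pf (pow_pf const_pf k) N p) = (#|'I_k| * 1 + dim (N p))%N.
  by [].
by rewrite card_ord muln1 leq_addr.
Qed.

Lemma multP M (p : P) : is_mult M (mult M).
Proof.
rewrite /mult; case: xgetP => [k _ //|none]; exfalso.
have ex : exists k, `[< const_summand M k >].
  by exists 0%N; apply/asboolP/const_summand0.
have ub k : `[< const_summand M k >] -> (k <= \dim {: M p})%N.
  by move/asboolP/const_summand_le_dim.
case: (ex_maxnP ex ub) => k /asboolP Mk kmax.
by apply: (none k); split=> // j Mj; apply/kmax/asboolP.
Qed.

End Functors.

Arguments const_pf : clear implicits.

Section Restriction.
Variables (K : fieldType) (dS dP : Order.disp_t).
Variables (S : porderType dS) (P : porderType dP).
Variables (M : pfunctor K P) (F : {omorphism S -> P}).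

Let mor s t (h : (s <= t)%O) := pmap M (omorph_le F h).
Fact restr_id (s : S) (h : (s <= s)%O) : mor h = \1%VF.
Proof. exact: pmap_id. Qed.
Fact restr_comp (s t r : S) (hst : (s <= t)%O) (htr : (t <= r)%O)
  (hsr : (s <= r)%O) : mor hsr = (mor htr \o mor hst)%VF.
Proof. exact: pmap_comp. Qed.
Definition restr : pfunctor K S :=
  @Pfunctor K dS S (fun s => M (F s)) mor restr_id restr_comp.

End Restriction.

(* Main.v *)
Require Import Defs.
From HB Require Import structures.
From mathcomp Require Import all_boot all_order all_algebra.
From mathcomp Require Import boolp classical_sets functions cardinality.

(* By fullness F embeds S into P. Let M q be the space of locally constant
   functions on F^-1(up q), that is, the right Kan extension along F of the
   constant functor on S. It is finite-dimensional because every element of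
   F^-1(up q) lies below one of finitely many elements of S, one above each
   t in T; and MF is constant, so the multiplicity equality yields maps
   i : K_P -> M and r : M -> K_P with r i = id. If x and y lie in different
   components of F^-1(up p), let f be the indicator function of the component
   of x: evaluating r_p f through M (F x) gives a nonzero scalar and through
   M (F y) gives 0. Dually, for (b) M q is the free space on the components of
   F^-1(down q), and i_p 1 would be a nonzero multiple of two distinct basis
   vectors. Nonemptiness of the fibres is obtained first, from the indicator
   functor of the complement of an up-set or down-set. *)

Set Implicit Arguments.
Unset Strict Implicit.
Unset Printing Implicit Defensive.

Import Order.TTheory GRing.Theory.

Local Open Scope classical_set_scope.
Local Open Scope ring_scope.

(* [pmap] also names the partial map of seq. *)
Local Notation pmap := Defs.pmap.

(** * Constant summands as retracts *)

Section ConstantSummands.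
Variables (K : fieldType) (d : Order.disp_t) (P : porderType d).
Implicit Types M : pfunctor K P.

Lemma const_summand_retract M k : const_summand M k -> (0 < k)%N ->
  exists (i : forall p, K^o -> M p) (r : forall p, {linear M p -> K^o}),
  [/\ forall p q (h : (p <= q)%O) a, i q a = pmap M h (i p a),
      forall p q (h : (p <= q)%O) u, r q (pmap M h u) = r p u &
      forall p a, r p (i p a) = a].
Proof.
case: k => // k [N [f [g [fn gn gf fg]]]] _.
have lin p : linear (fun u => (f p u).1 ord0 : K^o).
  by move=> a u v; rewrite linearP /= !ffunE.
pose rL p := GRing.isLinear.Build _ _ _ _ _ (lin p).
pose r p : {linear M p -> K^o} :=
  HB.pack (fun u => (f p u).1 ord0 : K^o) (rL p).
(* [i] is the diagonal into the power and [r] reads coordinate [ord0], which exists since the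
   exponent is a successor. *)
exists (fun p a => g p ([ffun=> a], 0)), r; split.
- move=> p q h a; rewrite -comp_lfunE -gn comp_lfunE sum_mapE /= linear0.
  congr (g q (_, _)); rewrite pow_mapE; apply/ffunP => j.
  by rewrite !ffunE id_lfunE.
- move=> p q h u; rewrite /r /= -comp_lfunE fn comp_lfunE sum_mapE /= pow_mapE.
  by rewrite ffunE id_lfunE.
- by move=> p a; rewrite /r /= -comp_lfunE fg id_lfunE ffunE.
Qed.

(** Naturality of [r] passes to its pointwise inverse [i]. The complement is the zero functor,
    obtained as a zeroth power. *)
Lemma const_summand1 M (i : forall p, {linear K^o -> M p})
    (r : forall p, {linear M p -> K^o}) :
  (forall p q (h : (p <= q)%O) u, r q (pmap M h u) = r p u) ->
  (forall p a, r p (i p a) = a) -> (forall p u, i p (r p u) = u) ->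
  const_summand M 1.
Proof.
move=> rn ri ir; exists (pow_pf (const_pf K d P) 0).
have in' p q (h : (p <= q)%O) a : pmap M h (i p a) = i q a.
  by rewrite -[LHS]ir rn ri.
pose a p (u : M p) : {ffun 'I_1 -> K^o} * {ffun 'I_0 -> K^o} :=
  ([ffun=> r p u], 0).
have a_lin p : linear (@a p).
  move=> c u v; congr pair; last by rewrite /= scaler0 addr0.
  by apply/ffunP => j; rewrite !ffunE linearP.
pose b p (u : {ffun 'I_1 -> K^o} * {ffun 'I_0 -> K^o}) : M p := i p (u.1 ord0).
have b_lin p : linear (b p).
  by move=> c u v; rewrite /b /= !ffunE linearP.
pose aL p := GRing.isLinear.Build _ _ _ _ _ (a_lin p).
pose al p : {linear M p -> ({ffun 'I_1 -> K^o} * {ffun 'I_0 -> K^o})%type} :=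
  HB.pack (@a p) (aL p).
pose bL p := GRing.isLinear.Build _ _ _ _ _ (b_lin p).
pose bl p : {linear ({ffun 'I_1 -> K^o} * {ffun 'I_0 -> K^o})%type -> M p} :=
  HB.pack (b p) (bL p).
have triv (u v : {ffun 'I_0 -> K^o}) : u = v by apply/ffunP => -[].
have ffun1 (u : {ffun 'I_1 -> K^o}) : [ffun=> u ord0] = u.
  by apply/ffunP => j; rewrite ffunE (ord1 j).
have pow1 (c : K^o) :
    pow_map (\1 : 'Hom(K^o, K^o))%VF 1 [ffun=> c] = [ffun=> c].
  by apply/ffunP => j; rewrite pow_mapE !ffunE id_lfunE.
exists (fun p => linfun (al p)), (fun p => linfun (bl p)); split.
- move=> p q h; apply/lfunP => u; rewrite !comp_lfunE !(lfunE (al _)) sum_mapE.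
  congr pair; last exact: triv.
  by rewrite /= /a /= rn -[RHS]/(pow_map \1 1 [ffun=> r p u]) pow1.
- move=> p q h; apply/lfunP => u; rewrite !comp_lfunE !(lfunE (bl _)) sum_mapE.
  by rewrite /= /b /= pow_mapE ffunE id_lfunE in'.
- move=> p; apply/lfunP => u.
  by rewrite comp_lfunE (lfunE (al _)) (lfunE (bl _)) id_lfunE /= /b ffunE ir.
- move=> p; apply/lfunP => -[u v].
  rewrite comp_lfunE (lfunE (bl _)) (lfunE (al _)) id_lfunE.
  congr pair; last exact: triv.
  by rewrite /= /b ri /=; exact: ffun1.
Qed.

End ConstantSummands.

(** The restriction has multiplicity at least 1, hence so does [M]; the point [x0] ensures that both
    multiplicities are attained maxima. *)
Lemma mult_restr_retract (K : fieldType) (dS dP : Order.disp_t)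
    (S : porderType dS) (P : porderType dP) (F : {omorphism S -> P})
    (M : pfunctor K P) (x0 : S) :
  mult M = mult (restr M F) -> const_summand (restr M F) 1 ->
  exists (i : forall p, K^o -> M p) (r : forall p, {linear M p -> K^o}),
  [/\ forall p q (h : (p <= q)%O) a, i q a = pmap M h (i p a),
      forall p q (h : (p <= q)%O) u, r q (pmap M h u) = r p u &
      forall p a, r p (i p a) = a].
Proof.
move=> eM s1; apply: const_summand_retract (multP M (F x0)).1 _.
by rewrite eM; apply: (multP (restr M F) x0).2.
Qed.

(** * Partial equivalence relations with finitely many classes *)

Definition per (S : Type) (E : S -> S -> Prop) : Prop :=
  (forall x y, E x y -> E y x) /\ (forall x y z, E x y -> E y z -> E x z).

(* [E x x] expresses that x lies in the domain of the partial equivalence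
   relation E; a functor of classes is given by a family of such relations on
   the single type S, monotone or antitone in P. *)
Section Classes.
Variables (S : choiceType) (r : seq S).
Implicit Types E : S -> S -> Prop.

Definition covers E := forall x, E x x -> exists2 y, y \in r & E x y.

(* On the domain of E, the first entry of r in the class of x; elsewhere x. *)
Definition rep E x : S := nth x r (find (fun y => `[< E x y >]) r).
Definition classes E : seq S := [seq rep E x | x <- r & `[< E x x >]].

Variable E : S -> S -> Prop.
Hypotheses (Eper : per E) (Ecov : covers E).

Let Esym x y : E x y -> E y x := Eper.1 x y.
Let Etrans x y z : E x y -> E y z -> E x z := Eper.2 x y z.
Let Exx x y : E x y -> E x x.
Proof. by move=> h; exact: Etrans h (Esym h). Qed.

Let has_rep x : E x x -> has (fun y => `[< E x y >]) r.
Proof.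
by move/Ecov => [y yr xy]; apply/hasP; exists y => //; apply/asboolP.
Qed.

Lemma rep_rel x : E x x -> E x (rep E x).
Proof. by move/has_rep/(nth_find x)/asboolP. Qed.

Lemma rep_eq x y : E x y -> rep E x = rep E y.
Proof.
move=> xy; rewrite /rep.
have /eq_find-> : (fun z => `[< E x z >]) =1 (fun z => `[< E y z >]).
  move=> z; apply/asbool_equiv_eq; split; first exact/Etrans/Esym.
  exact/Etrans.
(* The defaults [x] and [y] differ, but the index is within [r] because [r] meets the class. *)
by apply: set_nth_default; rewrite -has_find; apply: has_rep (Exx (Esym xy)).
Qed.

Lemma rep_inj x y : E x x -> E y y -> rep E x = rep E y -> E x y.
Proof.
by move=> xx yy e; apply: Etrans (rep_rel xx) _; rewrite e; apply/Esym/rep_rel.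
Qed.

Lemma rep_classes x : E x x -> rep E x \in classes E.
Proof.
move=> xx; rewrite (rep_eq (rep_rel xx)); apply: map_f; rewrite mem_filter.
apply/andP; split; first by apply/asboolP/(Exx (Esym (rep_rel xx))).
by apply: mem_nth; rewrite -has_find has_rep.
Qed.

Lemma classesP z : z \in classes E -> E z z /\ rep E z = z.
Proof.
case/mapP => x; rewrite mem_filter => /andP[/asboolP xx _] ->.
have h := rep_rel xx; split; first exact: Exx (Esym h).
by rewrite -(rep_eq h).
Qed.

End Classes.

(** * Vectors indexed by classes *)

Section Coefficients.
Variables (K : fieldType) (S : choiceType) (r : seq S) (E : S -> S -> Prop).

(** Reads [f] as a function on [S], constant on each class and, for a partial equivalence covered by
    [r], zero off its domain. *)
Definition coeff (x : S) (f : {ffun seq_sub (classes r E) -> K^o}) : K^o :=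
  if insub (rep r E x) is Some i then f i else 0.

Fact coeff_linear x : linear (coeff x).
Proof.
move=> a f g; rewrite /coeff; case: insubP => [i _ _|_].
  by rewrite !ffunE.
by rewrite scaler0 addr0.
Qed.
HB.instance Definition _ x :=
  GRing.isLinear.Build K _ K^o _ (coeff x) (coeff_linear x).

Hypotheses (Eper : per E) (Ecov : covers r E).

Lemma coeff_rel x y f : E x y -> coeff x f = coeff y f.
Proof. by move=> xy; rewrite /coeff (rep_eq Eper Ecov xy). Qed.

Lemma coeff_val (i : seq_sub (classes r E)) f : coeff (val i) f = f i.
Proof. by rewrite /coeff (classesP Eper Ecov (valP i)).2 valK. Qed.

Definition class_ind (x : S) : {ffun seq_sub (classes r E) -> K^o} :=
  [ffun i => (val i == rep r E x)%:R].

Lemma coeff_ind x y : E x x -> E y y -> coeff y (class_ind x) = `[< E x y >]%:R.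
Proof.
move=> xx yy; rewrite /coeff; case: insubP => [i _ iE|]; last first.
  by rewrite (rep_classes Eper Ecov yy).
rewrite ffunE iE; congr (_%:R); congr nat_of_bool.
apply/eqP/asboolP => [e|/(rep_eq Eper Ecov)//].
by apply: (rep_inj Eper Ecov).
Qed.

End Coefficients.

(** * Linear maps between spaces of classes *)

Section Transitions.
Variables (K : fieldType) (S : choiceType) (r : seq S).
Implicit Types E : S -> S -> Prop.

Definition ind_mul E x (a : K^o) := a *: class_ind K r E x.
Fact ind_mul_linear E x : linear (ind_mul E x).
Proof. by move=> a b c; rewrite /ind_mul scalerDl scalerA. Qed.
HB.instance Definition _ E x :=
  GRing.isLinear.Build K K^o _ _ (ind_mul E x) (ind_mul_linear E x).

(** Restriction of functions constant on classes, meant for [E'] contained in [E]. *)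
Definition pull E E' (f : {ffun seq_sub (classes r E) -> K^o}) :
    {ffun seq_sub (classes r E') -> K^o} :=
  [ffun i => coeff (val i) f].
Arguments pull : clear implicits.
Fact pull_linear E E' : linear (pull E E').
Proof. by move=> a f g; apply/ffunP => i; rewrite !ffunE linearP. Qed.
HB.instance Definition _ E E' :=
  GRing.isLinear.Build K _ _ _ (pull E E') (@pull_linear E E').

(** The map of free spaces induced by sending classes of [E] to classes of [E'], meant for [E]
    contained in [E']. *)
Definition push E E' (f : {ffun seq_sub (classes r E) -> K^o}) :
    {ffun seq_sub (classes r E') -> K^o} :=
  [ffun i => \sum_(j | rep r E' (val j) == val i) f j].
Arguments push : clear implicits.
Fact push_linear E E' : linear (push E E').
Proof.
move=> a f g; apply/ffunP => i; rewrite !ffunE scaler_sumr -big_split.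
by apply: eq_bigr => j _; rewrite !ffunE.
Qed.
HB.instance Definition _ E E' :=
  GRing.isLinear.Build K _ _ _ (push E E') (@push_linear E E').

Definition total E (f : {ffun seq_sub (classes r E) -> K^o}) : K^o :=
  \sum_i f i.
Fact total_linear E : linear (@total E).
Proof.
move=> a f g; rewrite /total scaler_sumr -big_split.
by apply: eq_bigr => j _; rewrite !ffunE.
Qed.
HB.instance Definition _ E :=
  GRing.isLinear.Build K _ _ _ (@total E) (@total_linear E).

Lemma one_class E x (f : {ffun seq_sub (classes r E) -> K^o}) :
  per E -> covers r E -> (forall y, E y y -> E x y) ->
  f = ind_mul E x (coeff x f).
Proof.
move=> Eper Ecov one; apply/ffunP => i; rewrite !ffunE.
have [ii ri] := classesP Eper Ecov (valP i).
rewrite -(coeff_val Eper Ecov) (coeff_rel Eper Ecov f (one _ ii)).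
by rewrite (rep_eq Eper Ecov (one _ ii)) ri eqxx -[RHS]/(_ * _) mulr1.
Qed.

Variables E E' : S -> S -> Prop.
Hypotheses (Eper : per E) (Ecov : covers r E).
Hypotheses (Eper' : per E') (Ecov' : covers r E').

Lemma coeff_pull x f : (forall y z, E' y z -> E y z) -> E' x x ->
  coeff x (pull E E' f) = coeff x f.
Proof.
move=> sub xx; rewrite {1}/coeff; case: insubP => [i _ iE|]; last first.
  by rewrite (rep_classes Eper' Ecov' xx).
rewrite ffunE iE; apply/esym/(coeff_rel Eper Ecov)/sub.
exact: (rep_rel Ecov' xx).
Qed.

Lemma push_ind x : (forall y z, E y z -> E' y z) -> E x x ->
  push E E' (class_ind K r E x) = class_ind K r E' x.
Proof.
move=> sub xx; apply/ffunP => i; rewrite !ffunE.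
pose j := SeqSub (rep_classes Eper Ecov xx).
rewrite (rep_eq Eper' Ecov' (sub _ _ (rep_rel Ecov xx))) eq_sym.
rewrite -[rep r E x]/(val j) big_mkcond (bigD1 j) //= big1 ?addr0.
  by rewrite ffunE eqxx; case: eqP.
move=> k kj; rewrite ffunE; case: ifP => // _.
by rewrite -[rep r E x]/(val j) val_eqE (negbTE kj).
Qed.

Lemma total_push f : (forall y z, E y z -> E' y z) ->
  total (push E E' f) = total f.
Proof.
move=> sub; rewrite /total.
have h (j : seq_sub (classes r E)) : E' (val j) (val j).
  by apply: sub; exact: (classesP Eper Ecov (valP j)).1.
pose c (j : seq_sub (classes r E)) := SeqSub (rep_classes Eper' Ecov' (h j)).
(* The classes of [E] are grouped by the class of [E'] containing them. *)
rewrite [RHS](partition_big c xpredT) //=; apply: eq_bigr => i _.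
by rewrite ffunE; apply: eq_bigl => j; rewrite -val_eqE.
Qed.

Lemma total_ind x : E x x -> total (class_ind K r E x) = 1.
Proof.
move=> xx; pose j := SeqSub (rep_classes Eper Ecov xx).
rewrite /total (bigD1 j) //= big1 ?addr0 ?ffunE ?eqxx // => k kj.
by rewrite ffunE -[rep r E x]/(val j) val_eqE (negbTE kj).
Qed.

End Transitions.

Arguments pull {K S r} E E' f.
Arguments push {K S r} E E' f.

(** * Functors of classes and the consequences of equal multiplicities *)

Section ClassFunctors.
Variables (K : fieldType) (dS dP : Order.disp_t).
Variables (S : porderType dS) (P : porderType dP) (F : {omorphism S -> P}).
Variables (r : seq S) (E : P -> S -> S -> Prop).
Hypotheses (Eper : forall p, per (E p)) (Ecov : forall p, covers r (E p)).
(** At [F s] there is exactly one class, that of [s], so the functor of classes restricts to lines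
    along [F]. *)
Hypothesis EF : forall s, E (F s) s s /\ forall x, E (F s) x x -> E (F s) s x.

Lemma class_fun_neq0 p (f : {ffun seq_sub (classes r (E p)) -> K^o}) :
  f != 0 -> exists x, E p x x.
Proof.
move=> f0; apply: contrapT => none; move/eqP: f0; apply; apply/ffunP => i.
by case: none; exists (val i); apply: (classesP (Eper p) (@Ecov p) (valP i)).1.
Qed.

(** * Relations shrinking along P: functions constant on classes *)

Section Contravariant.
Hypothesis Emono : forall p q, (p <= q)%O -> forall x y, E q x y -> E p x y.

Let mor p q (h : (p <= q)%O) :
    'Hom({ffun seq_sub (classes r (E p)) -> K^o},
         {ffun seq_sub (classes r (E q)) -> K^o}) :=
  linfun (pull (E p) (E q)).

Let mor_id (p : P) (h : (p <= p)%O) : mor h = \1%VF.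
Proof.
apply/lfunP => f; rewrite lfunE id_lfunE; apply/ffunP => i.
by rewrite ffunE (coeff_val (Eper p) (@Ecov p)).
Qed.

Let mor_comp (p q s : P) (hpq : (p <= q)%O) (hqs : (q <= s)%O)
  (hps : (p <= s)%O) : mor hps = (mor hqs \o mor hpq)%VF.
Proof.
apply/lfunP => f; rewrite comp_lfunE !lfunE; apply/ffunP => i.
rewrite !ffunE (coeff_pull (Eper p) (@Ecov p) (Eper q) (@Ecov q)) //.
  exact: Emono.
apply: (Emono hqs); exact: (classesP (Eper s) (@Ecov s) (valP i)).1.
Qed.

Definition pull_pf : pfunctor K P := Pfunctor mor_id mor_comp.

Lemma pull_pf_restr : const_summand (restr pull_pf F) 1.
Proof.
apply: (@const_summand1 _ _ _ (restr pull_pf F)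
  (fun s => ind_mul r (E (F s)) s) (fun s => coeff s)) => [s t h u|s a|s u].
- have Fst := omorph_le F h.
  rewrite /= lfunE /= (coeff_pull (Eper _) (@Ecov _) (Eper _) (@Ecov _)).
  + apply/esym/(coeff_rel (Eper _) (@Ecov _))/(EF s).2.
    exact/(Emono Fst)/(EF t).1.
  + exact: Emono.
  + exact: (EF t).1.
- rewrite /ind_mul linearZ /=.
  rewrite (coeff_ind _ (Eper _) (@Ecov _) (EF s).1 (EF s).1).
  by case: asboolP => [_|]; [rewrite -[LHS]/(_ * _) mulr1 | case: (EF s)].
- exact/esym/(one_class _ (Eper _) (@Ecov _) (EF s).2).
Qed.

Lemma contravariant_classes (x0 : S) p :
  mult pull_pf = mult (restr pull_pf F) ->
  (exists x, E p x x) /\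
  forall x y, (p <= F x)%O -> (p <= F y)%O -> E p x y.
Proof.
move=> /(@mult_restr_retract K dS dP S P F pull_pf x0)-/(_ pull_pf_restr).
move=> [i [t [ni nt ti]]]; split.
  apply: (class_fun_neq0 (f := i p 1)); apply/eqP => e.
  by have := ti p 1; rewrite e linear0 => /esym/eqP; rewrite oner_eq0.
move=> x y px py; apply: contrapT => nxy.
have xx : E p x x by apply/(Emono px)/(EF x).1.
have yy : E p y y by apply/(Emono py)/(EF y).1.
pose f := class_ind K r (E p) x.
(* By naturality [t p f] can be computed at [F z], where [f] restricts to a constant: 1 if [z] is in
   the class of [x], else 0. *)
have tE z (pz : (p <= F z)%O) :
    t p f = (`[< E p x z >]%:R : K) *: t (F z) (class_ind K r (E (F z)) z).
  rewrite -(nt _ _ pz) /= lfunE /=.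
  rewrite [pull _ _ _](one_class _ (Eper _) (@Ecov _) (EF z).2).
  rewrite (coeff_pull (Eper _) (@Ecov _) (Eper _) (@Ecov _)); last 2 first.
  - exact: Emono.
  - exact: (EF z).1.
  rewrite coeff_ind //; last exact/(Emono pz)/(EF z).1.
  by rewrite linearZ.
(* Comparing [z = x] with [z = y] shows that [t (F x)] kills the generator of its line, against
   [ti]. *)
have := tE _ py; rewrite (tE _ px).
rewrite (asboolT xx) (asboolF nxy) scale0r scale1r => t0.
have := ti (F x) 1.
rewrite [i _ _](one_class _ (Eper _) (@Ecov _) (EF x).2) linearZ /= t0 scaler0.
by move/esym/eqP; rewrite oner_eq0.
Qed.

End Contravariant.

(** * Relations growing along P: free spaces on classes *)

Section Covariant.
Hypothesis Emono : forall p q, (p <= q)%O -> forall x y, E p x y -> E q x y.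

Let mor p q (h : (p <= q)%O) :
    'Hom({ffun seq_sub (classes r (E p)) -> K^o},
         {ffun seq_sub (classes r (E q)) -> K^o}) :=
  linfun (push (E p) (E q)).

Let mor_id (p : P) (h : (p <= p)%O) : mor h = \1%VF.
Proof.
apply/lfunP => f; rewrite lfunE id_lfunE; apply/ffunP => i.
rewrite ffunE (eq_bigl (pred1 i)) ?big_pred1_eq // => j.
by rewrite (classesP (Eper p) (@Ecov p) (valP j)).2.
Qed.

Let mor_comp (p q s : P) (hpq : (p <= q)%O) (hqs : (q <= s)%O)
  (hps : (p <= s)%O) : mor hps = (mor hqs \o mor hpq)%VF.
Proof.
apply/lfunP => f; rewrite comp_lfunE !lfunE; apply/ffunP => i.
rewrite !ffunE.
have h (j : seq_sub (classes r (E p))) : E q (val j) (val j).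
  by apply: (Emono hpq); exact: (classesP (Eper p) (@Ecov p) (valP j)).1.
pose c (j : seq_sub (classes r (E p))) :=
  SeqSub (rep_classes (Eper q) (@Ecov q) (h j)).
have cE j : rep r (E s) (val (c j)) = rep r (E s) (val j).
  apply/esym/(rep_eq (Eper s) (@Ecov s))/(Emono hqs).
  exact: (rep_rel (@Ecov q)).
(* The sum over classes at [p] is grouped by the intermediate class [c j] at [q]. *)
rewrite (partition_big c (fun k => rep r (E s) (val k) == val i)) => [|j];
  last by rewrite cE.
apply: eq_bigr => k /eqP ki; rewrite ffunE; apply: eq_bigl => j.
rewrite -[c j == k]val_eqE /=; apply: andb_idl => /eqP jk.
by rewrite -cE -ki /= jk.
Qed.

Definition push_pf : pfunctor K P := Pfunctor mor_id mor_comp.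

Lemma push_pf_restr : const_summand (restr push_pf F) 1.
Proof.
apply: (@const_summand1 _ _ _ (restr push_pf F)
  (fun s => ind_mul r (E (F s)) s) (fun s => @total K S r (E (F s))))
  => [s t h u|s a|s u].
- rewrite /= lfunE /= (total_push (Eper _) (@Ecov _) (Eper _) (@Ecov _)) //.
  exact: Emono (omorph_le F h).
- rewrite /ind_mul linearZ /= (total_ind _ (Eper _) (@Ecov _) (EF s).1).
  by rewrite -[LHS]/(_ * _) mulr1.
- rewrite [in RHS](one_class u (Eper _) (@Ecov _) (EF s).2).
  rewrite [in LHS](one_class u (Eper _) (@Ecov _) (EF s).2).
  rewrite {2}/ind_mul linearZ /= (total_ind _ (Eper _) (@Ecov _) (EF s).1).
  by rewrite -[_ *: _]/(_ * _) mulr1.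
Qed.

Lemma covariant_classes (x0 : S) p :
  mult push_pf = mult (restr push_pf F) ->
  (exists x, E p x x) /\
  forall x y, (F x <= p)%O -> (F y <= p)%O -> E p x y.
Proof.
move=> /(@mult_restr_retract K dS dP S P F push_pf x0)-/(_ push_pf_restr).
move=> [i [t [ni nt ti]]].
have i0 : i p 1 <> 0.
  by move=> e; have := ti p 1; rewrite e linear0 => /esym/eqP; rewrite oner_eq0.
split; first by apply: (class_fun_neq0 (f := i p 1)); exact/eqP.
move=> x y xp yp; apply: contrapT => nxy.
(* [i p 1] is pushed forward from the line at [F z], so it is a multiple of the class of [z]. *)
have iE z (zp : (F z <= p)%O) :
    exists c : K, i p 1 = c *: class_ind K r (E p) z.
  exists (coeff z (i (F z) 1)).
  rewrite (ni _ _ zp) /= lfunE /=.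
  rewrite {1}[i _ _](one_class _ (Eper _) (@Ecov _) (EF z).2) linearZ /=.
  rewrite (push_ind _ (Eper _) (@Ecov _) (Eper _) (@Ecov _)) //.
  - exact: Emono.
  - exact: (EF z).1.
have xx : E p x x by apply/(Emono xp)/(EF x).1.
have yy : E p y y by apply/(Emono yp)/(EF y).1.
have [a ia] := iE _ xp; have [b ib] := iE _ yp.
(* The coefficient at [y] is [b] by [ib] and 0 by [ia]. *)
have := congr1 (coeff y) ia; rewrite {1}ib !linearZ /= !coeff_ind //.
rewrite (asboolT yy) (asboolF nxy) scaler0 -[_ *: _]/(_ * _) mulr1 => b0.
by apply: i0; rewrite ib b0 scale0r.
Qed.

End Covariant.

End ClassFunctors.

(** * Connected components as zigzag classes *)

Section Zigzags.
Variables (d : Order.disp_t) (S : porderType d).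
Implicit Types (A B : set S) (x y z : S).

(** The conjunct [A x] makes this a partial equivalence with domain [A], whose classes are the
    connected components of [A]. *)
Definition zigzag A x y : Prop :=
  A x /\ exists s : seq S,
    [/\ forall z, z \in s -> A z, path >=<%O x s & last x s = y].

Lemma zigzag_comparable A x y : A x -> A y -> (x >=< y)%O -> zigzag A x y.
Proof.
move=> Ax Ay xy; split=> //; exists [:: y]; split; rewrite /= ?xy // => z.
by rewrite inE => /eqP ->.
Qed.

Lemma zigzag_per A : per (zigzag A).
Proof.
split=> [x y [Ax [s [As ps <-]]]|x y z [Ax [s [As ps <-]]] [_ [t [At pt tz]]]].
  have Axs w : w \in x :: s -> A w.
    by rewrite inE => /orP[/eqP ->//|]; apply: As.
  split; first by apply: Axs; exact: mem_last.
  exists (rev (belast x s)); split.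
  - by move=> w; rewrite mem_rev => /mem_belast; apply: Axs.
  - rewrite rev_path; apply: sub_path ps => a b.
    by rewrite comparable_sym.
  - by case: s {ps As Axs} => //= a s; rewrite rev_cons last_rcons.
split=> //; exists (s ++ t); split.
- by move=> w; rewrite mem_cat => /orP[/As|/At].
- by rewrite cat_path ps.
- by rewrite last_cat.
Qed.

Lemma zigzag_sub A B x y : A `<=` B -> zigzag A x y -> zigzag B x y.
Proof.
move=> AB [Ax [s [As ps e]]]; split; first exact: AB.
by exists s; split=> // z /As/AB.
Qed.

Lemma zigzag_connected A :
  A !=set0 -> (forall x y, A x -> A y -> zigzag A x y) ->
  connected_poset A.
Proof. by move=> A0 zA; split=> // x y Ax Ay; case: (zA x y Ax Ay). Qed.

End Zigzags.

(** * Nonempty and connected fibres *)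

Section FinalInitial.
Variables (K : fieldType) (dS dP : Order.disp_t).
Variables (S : porderType dS) (P : porderType dP) (F : {omorphism S -> P}).
Hypothesis eqmult : forall M : pfunctor K P, mult M = mult (restr M F).

Lemma const_per (Q : Prop) : per (fun _ _ : S => Q).
Proof. by []. Qed.

Lemma const_covers (Q : Prop) x0 : covers [:: x0] (fun _ _ : S => Q).
Proof. by move=> x q; exists x0; rewrite ?mem_head. Qed.

(* Otherwise the functor equal to K off the up-set of p and to 0 on it would
   restrict to the constant functor on S. *)
Lemma mult_up_nonempty (x0 : S) p : exists x, (p <= F x)%O.
Proof.
apply: contrapT => none.
pose E (q : P) (_ _ : S) := ~ (p <= q)%O.
have Eper q : per (E q) := const_per (~ (p <= q)%O).
have Ecov q : covers [:: x0] (E q) := @const_covers (~ (p <= q)%O) x0.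
have EF s : E (F s) s s /\ forall x, E (F s) x x -> E (F s) s x.
  by split=> // ps; apply: none; exists s.
have Emono q q' : (q <= q')%O -> forall x y, E q' x y -> E q x y.
  by move=> qq' x y nq' pq; apply/nq'/(le_trans pq).
have [[x /(_ (lexx p)) //] _] :=
  contravariant_classes EF x0 p (eqmult (pull_pf K Eper Ecov Emono)).
Qed.

(** Dually, the functor is [K] off the down-set of [p] and 0 on it; if no [F x] were below [p], it
    would restrict to the constant functor. *)
Lemma mult_down_nonempty (x0 : S) p : exists x, (F x <= p)%O.
Proof.
apply: contrapT => none.
pose E (q : P) (_ _ : S) := ~ (q <= p)%O.
have Eper q : per (E q) := const_per (~ (q <= p)%O).
have Ecov q : covers [:: x0] (E q) := @const_covers (~ (q <= p)%O) x0.
have EF s : E (F s) s s /\ forall x, E (F s) x x -> E (F s) s x.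
  by split=> // ps; apply: none; exists s.
have Emono q q' : (q <= q')%O -> forall x y, E q x y -> E q' x y.
  by move=> qq' x y nq' pq; apply/nq'/(le_trans qq').
have [[x /(_ (lexx p)) //] _] :=
  covariant_classes EF x0 p (eqmult (push_pf K Eper Ecov Emono)).
Qed.

Hypotheses (Ffull : full F) (x0 : S).

Lemma mult_final (T : set P) :
  finite_set T -> [set: P] = downset T -> final F.
Proof.
move=> /finite_seqP[ts ->] PT p.
have [g gP] := choice (mult_up_nonempty x0).
pose E q := zigzag (F @^-1` up q).
have Eper q : per (E q) by exact: zigzag_per.
(* If [F x] is below [t], then it is below [F (g t)], and fullness gives [x] below [g t]. *)
have Ecov q : covers (map g ts) (E q).
  move=> x [qx _]; have : downset [set` ts] (F x) by rewrite -PT.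
  case=> t tts xt; exists (g t); first exact: map_f.
  have xgt : (F x <= F (g t))%O := le_trans xt (gP t).
  apply: zigzag_comparable => //; first exact: le_trans qx xgt.
  by rewrite /Order.comparable -Ffull xgt.
(* By fullness [s] is a least element of the fibre over [up (F s)], which is therefore a single
   component. *)
have EF s : E (F s) s s /\ forall x, E (F s) x x -> E (F s) s x.
  split=> [|x [sx _]].
    by apply: zigzag_comparable (comparablexx _); exact: lexx.
  apply: zigzag_comparable => //; first exact: lexx.
  by rewrite /Order.comparable -Ffull sx.
have Emono q q' : (q <= q')%O -> forall x y, E q' x y -> E q x y.
  by move=> qq' x y; apply: zigzag_sub => z; apply: le_trans.
have [_ conn] :=
  contravariant_classes EF x0 p (eqmult (pull_pf K Eper Ecov Emono)).
by apply: zigzag_connected => //; exists (g p); exact: gP.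
Qed.

(** Dually, [F (g t)] lies below [t], so each [x] has some [g t] below it, and [s] is greatest in
    the fibre over [down (F s)]. *)
Lemma mult_initial (T : set P) :
  finite_set T -> [set: P] = upset T -> initial F.
Proof.
move=> /finite_seqP[ts ->] PT p.
have [g gP] := choice (mult_down_nonempty x0).
pose E q := zigzag (F @^-1` Defs.down q).
have Eper q : per (E q) by exact: zigzag_per.
have Ecov q : covers (map g ts) (E q).
  move=> x [qx _]; have : upset [set` ts] (F x) by rewrite -PT.
  case=> t tts xt; exists (g t); first exact: map_f.
  have xgt : (F (g t) <= F x)%O := le_trans (gP t) xt.
  apply: zigzag_comparable => //; first exact: le_trans xgt qx.
  by rewrite /Order.comparable -[(g t <= x)%O]Ffull xgt orbT.
have EF s : E (F s) s s /\ forall x, E (F s) x x -> E (F s) s x.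
  split=> [|x [sx _]].
    by apply: zigzag_comparable (comparablexx _); exact: lexx.
  apply: zigzag_comparable => //; first exact: lexx.
  by rewrite /Order.comparable -[(x <= s)%O]Ffull sx orbT.
have Emono q q' : (q <= q')%O -> forall x y, E q x y -> E q' x y.
  by move=> qq' x y; apply: zigzag_sub => z zq; apply: le_trans zq qq'.
have [_ conn] :=
  covariant_classes EF x0 p (eqmult (push_pf K Eper Ecov Emono)).
by apply: zigzag_connected => //; exists (g p); exact: gP.
Qed.

End FinalInitial.

Theorem proposition4 (K : fieldType) (dS dP : Order.disp_t)
    (S : porderType dS) (P : porderType dP) (F : {omorphism S -> P}) :
  full F -> connected_poset [set: S] -> connected_poset [set: P] ->
  ((exists T : set P, finite_set T /\ [set: P] = downset T) ->
   (forall A B : set P, down_shape A -> down_shape B ->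
      A `&` B !=set0 -> maxs (A `&` B) !=set0) ->
   (forall M : pfunctor K P, mult M = mult (restr M F)) ->
   final F)
  /\
  ((exists T : set P, finite_set T /\ [set: P] = upset T) ->
   (forall A B : set P, up_shape A -> up_shape B ->
      A `&` B !=set0 -> mins (A `&` B) !=set0) ->
   (forall M : pfunctor K P, mult M = mult (restr M F)) ->
   initial F).
Proof.
move=> Ffull [[x0 _] _] _; split=> -[T [finT PT]] _ eqmult.
- exact: (mult_final eqmult Ffull x0 finT PT).
- exact: (mult_initial eqmult Ffull x0 finT PT).
Qed.
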